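(* Let $\mathcal{T}\subset\binom{[n]}{3}$ be a $2$-resilient family with matching number $\nu(\mathcal{T})=2$. Then for any $u,v\in[n]$, $|\mathcal{T}_{uv}|\le 36$, where $\mathcal{T}_{uv}=\{T\in\mathcal{T}: T\cap\{u,v\}\neq\emptyset\}$.
   Context: $[n]=\{1,\dots,n\}$ and $\binom{[n]}{3}$ is the family of all $3$-element subsets of $[n]$. The matching number $\nu(\mathcal{F})$ of a family $\mathcal{F}$ is the maximum number of pairwise disjoint members of $\mathcal{F}$. For $T\subset[n]$, $\mathcal{F}(\overline{T})=\{F\in\mathcal{F}: F\cap T=\emptyset\}$. A family $\mathcal{F}$ is $t$-resilient if $\nu(\mathcal{F}(\overline{T}))=\nu(\mathcal{F})$ for every $T\subset[n]$ with $|T|\le t$. *)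

(* Defs.v *)
From mathcomp Require Import all_boot.

Set Implicit Arguments.
Unset Strict Implicit.
Unset Printing Implicit Defensive.

(* The ground set [n] = {1, ..., n} is represented by 'I_n = {0, ..., n - 1}. *)

Definition ksubsets (n k : nat) : {set {set 'I_n}} :=
  [set A : {set 'I_n} | #|A| == k].

Definition matching_number (n : nat) (F : {set {set 'I_n}}) : nat :=
  \max_(M : {set {set 'I_n}} | (M \subset F) && trivIset M) #|M|.

Definition avoiding (n : nat) (F : {set {set 'I_n}}) (T : {set 'I_n}) :
    {set {set 'I_n}} :=
  [set A in F | A :&: T == set0].

Definition meeting (n : nat) (F : {set {set 'I_n}}) (T : {set 'I_n}) :
    {set {set 'I_n}} :=
  [set A in F | A :&: T != set0].

Definition resilient (n t : nat) (F : {set {set 'I_n}}) : Prop :=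
  forall T : {set 'I_n}, #|T| <= t ->
    matching_number (avoiding F T) = matching_number F.

(* Main.v *)
(** Assume [u <> v] and take disjoint edges [A], [B] avoiding both. Put
    [W = A :|: B]. As no three edges are disjoint, every edge meets [W], so the
    edges to count are: the pairs inside [W] in the links of [u] and [v], the link
    pairs with one end in [W], and the triples [{u, v, x}] with [x] in [W].

    Removing [{u, x}] leaves disjoint edges [C], [D], whose union is a 6-set which
    contains the link neighbours of [x] and meets every edge, in particular [A] and
    [B]. This bounds the degree of [x] in the link of [u] by 6, and improves the
    bound to 5 for the neighbours outside [A], or outside [B]. Moreover, a disjoint
    pair of link edges, one for [u] and one for [v], cannot avoid [A] or [B]; so the
    two links outside [A] cross-intersect, which leaves few shapes for them. For
    each pair of shapes the bound follows from the degree bounds by linear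
    arithmetic; the tight value 36 is attained by all triples of an 8-set. *)

Require Import Defs.
From mathcomp Require Import all_boot zify.

Set Implicit Arguments.
Unset Strict Implicit.
Unset Printing Implicit Defensive.

Lemma uniq_cards3 (T : finType) (x y z : T) :
  #|[set x; y; z]| = 3 -> uniq [:: x; y; z].
Proof.
move=> xyz3; apply/card_uniqP; rewrite -[RHS]xyz3.
by apply: eq_card => t; rewrite !inE orbA.
Qed.

Lemma disjoint_setU1 (T : finType) (x : T) (A B : {set T}) :
  [disjoint x |: A & B] = (x \notin B) && [disjoint A & B].
Proof. by rewrite -disjointU1; apply: eq_disjoint => y; rewrite !inE. Qed.

(** For the adjacency function of a simple graph, this is the number of edges inside [s]. *)
Fixpoint pair_sum (T : Type) (f : T -> T -> nat) (s : seq T) : nat :=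
  if s is x :: s' then \sum_(y <- s') f x y + pair_sum f s' else 0.

(** * Shapes of two weighted graphs on a triple, and the arithmetic bound *)

Section Weights.
Variable T : eqType.
Implicit Types (g h : T -> T -> nat) (r s c : T -> nat) (x y z : T).

(* In the application [g] and [h] are the link graphs of [u] and [v], [r x] and [s x]
   count the neighbours of [x] in them outside [W], and [c x] tells whether
   [{u, v, x}] is an edge. *)
Definition simple_adj g :=
  [/\ forall x y, g x y = g y x, forall x, g x x = 0 & forall x y, g x y <= 1].

(** This and [balanced] are what cross-intersection of the two links outside one of [A], [B] says
    about the other one, listed by [t]. *)
Definition exclusive g s (t : seq T) := forall x y z,
  x \in t -> y \in t -> z \in t -> uniq [:: x; y; z] -> 0 < g x y -> s z = 0.

Definition balanced r s (t : seq T) := forall x y,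
  x \in t -> y \in t -> x != y -> 0 < s y -> r x <= 1.

(** Shapes are stated as linear constraints on the weights of one side, ready for [lia]. This one
    arises when all outer degrees are at most 1. *)
Definition few g h r s x y z :=
  g x y + g x z + g y z + r x + r y + r z
  + (h x y + h x z + h y z + s x + s y + s z) <= 6.

Definition two_stars g h r s (x : T) y z :=
  g y z + r y + r z + (h y z + s y + s z) = 0.

Definition near_star g h r s x y z :=
  g y z + r y + r z + (h x y + h x z + h y z + s x + s y + s z) <= 3.

(** If the single edge of [h] is [x y], exclusivity makes [r] vanish at the third vertex [z]. *)
Definition one_edge h r s x y z :=
  [/\ r z = 0, h x y + h x z + h y z <= 1 & s x + s y + s z = 0].

Definition no_edge h s x y z :=
  h x y + h x z + h y z + s x + s y + s z = 0.

Definition lopsided g h r s x y z :=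
  [\/ near_star g h r s x y z, one_edge h r s x y z | no_edge h s x y z].

Definition side_type g h r s x y z :=
  [\/ few g h r s x y z, two_stars g h r s x y z,
      lopsided g h r s x y z | lopsided h g s r x y z].

(** From [2 <= r x], balance gives [s y = s z = 0] and exclusivity gives [h y z = 0]. What remains
    is a case split on [s x] and on the two possible edges of [h] at [x]; the last alternative swaps
    [y] and [z] because a single edge of [h] may be [x z]. *)
Lemma heavy_side_type g h r s x y z (t := [:: x; y; z]) :
    simple_adj g -> simple_adj h -> uniq t ->
    exclusive g s t -> exclusive h r t -> balanced r s t -> balanced s r t ->
    2 <= r x ->
  [\/ two_stars g h r s x y z, lopsided g h r s x y z
    | lopsided g h r s x z y].
Proof.
move=> [gC g0 g1] [hC h0 h1] ut Xg Xh Brs Bsr rx.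
have mx : x \in t by rewrite !inE eqxx.
have my : y \in t by rewrite !inE eqxx orbT.
have mz : z \in t by rewrite !inE eqxx !orbT.
have := ut; rewrite /= !inE negb_or => /and3P[/andP[xy xz] yz _].
have sy : s y = 0.
  by apply/eqP; rewrite eqn0Ngt; apply/negP => /(Brs _ _ mx my xy); lia.
have sz : s z = 0.
  by apply/eqP; rewrite eqn0Ngt; apply/negP => /(Brs _ _ mx mz xz); lia.
have hyz : h y z = 0.
  apply/eqP; rewrite eqn0Ngt; apply/negP => /(Xh _ _ _ my mz mx); rewrite /= !inE negb_or yz.
  by rewrite ![_ == x]eq_sym xy xz => /(_ isT); lia.
have Xgx : 0 < g y z -> s x = 0.
  by apply: Xg => //; rewrite /= !inE negb_or yz ![_ == x]eq_sym xy xz.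
have Xhz : 0 < h x y -> r z = 0 by apply: Xh.
have Xhy : 0 < h x z -> r y = 0.
  by apply: Xh => //; rewrite /= !inE negb_or xy xz eq_sym yz.
have By := Bsr x y mx my xy; have Bz := Bsr x z mx mz xz.
have Cy : 0 < s x -> r y <= 1 by apply: Brs => //; rewrite eq_sym.
have Cz : 0 < s x -> r z <= 1 by apply: Brs => //; rewrite eq_sym.
have := (g1 y z, h1 x y, h1 x z) => -[[gyz1 hxy1] hxz1].
have [sx2|sx1] := leqP 2 (s x).
  by constructor 1; rewrite /two_stars; lia.
have [sx0|sx0] := posnP (s x); last first.
  (* Here [s x = 1], so [g y z = 0]; each of [h x y + r z] and [h x z + r y] is at most 1, for a
     total of 3. *)
  by constructor 2; constructor 1; rewrite /near_star; lia.
have [hxy0|hxy0] := posnP (h x y).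
  have [hxz0|hxz0] := posnP (h x z).
    by constructor 2; constructor 3; rewrite /no_edge; lia.
  by constructor 3; constructor 2; split; rewrite ?(hC z y); lia.
have [hxz0|hxz0] := posnP (h x z).
  by constructor 2; constructor 2; split; lia.
by constructor 2; constructor 1; rewrite /near_star; lia.
Qed.

Lemma side_typeC g h r s x y z : side_type g h r s x y z -> side_type h g s r x y z.
Proof.
case=> H; [constructor 1|constructor 2|constructor 4|constructor 3] => //;
  move: H; rewrite /few /two_stars; lia.
Qed.

Lemma heavy_vertex_side_type g h r s x (t : seq T) : size t = 3 ->
    simple_adj g -> simple_adj h -> uniq t ->
    exclusive g s t -> exclusive h r t -> balanced r s t -> balanced s r t ->
    x \in t -> 2 <= r x ->
  exists x' y' z', perm_eq [:: x'; y'; z'] t /\ side_type g h r s x' y' z'.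
Proof.
move=> t3 Sg Sh ut Xg Xh Brs Bsr xt rx.
have pt := perm_to_rem xt.
case Et: (rem x t) pt => [|y [|z [|? ?]]] pt; try by have := perm_size pt; rewrite t3.
have p : perm_eq [:: x; y; z] t by rewrite perm_sym.
have [] := @heavy_side_type g h r s x y z => //.
- by rewrite (perm_uniq p).
- by move=> a b d; rewrite !(perm_mem p); apply: Xg.
- by move=> a b d; rewrite !(perm_mem p); apply: Xh.
- by move=> a b; rewrite !(perm_mem p); apply: Brs.
- by move=> a b; rewrite !(perm_mem p); apply: Bsr.
- by exists x, y, z; split=> //; constructor 2.
- by exists x, y, z; split=> //; constructor 3.
exists x, z, y; split; last by constructor 3.
by apply: perm_trans p; rewrite perm_cons (perm_catC [:: z] [:: y]).
Qed.

Lemma side_typeP g h r s (t : seq T) : size t = 3 ->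
    simple_adj g -> simple_adj h -> uniq t ->
    exclusive g s t -> exclusive h r t -> balanced r s t -> balanced s r t ->
  exists x y z, perm_eq [:: x; y; z] t /\ side_type g h r s x y z.
Proof.
move=> t3 Sg Sh ut Xg Xh Brs Bsr.
have [/hasP[x xt rx]|r1] := boolP (has (fun x => 2 <= r x) t).
  exact: (heavy_vertex_side_type t3 Sg Sh ut Xg Xh Brs Bsr xt rx).
have [/hasP[x xt sx]|s1] := boolP (has (fun x => 2 <= s x) t).
  have [a [b [d [p H]]]] := heavy_vertex_side_type t3 Sh Sg ut Xh Xg Bsr Brs xt sx.
  by exists a, b, d; split => //; apply: side_typeC.
case: t t3 ut Xg Xh {Brs Bsr} r1 s1 => [|x [|y [|z [|? ?]]]] // _ ut Xg Xh.
rewrite /= !orbF !negb_or -!leqNgt => /and3P[rx ry rz] /and3P[sx sy sz].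
exists x, y, z; split; first exact: perm_refl.
(* A pair of the triple, together with the outer degree of the other graph at the opposite vertex,
   contributes at most 1: three for each graph, hence 6. *)
constructor 1; rewrite /few.
have := ut; rewrite /= !inE negb_or => /and3P[/andP[xy xz] yz _].
have [mx my mz] : [/\ x \in [:: x; y; z], y \in [:: x; y; z] & z \in [:: x; y; z]].
  by rewrite !inE !eqxx !orbT.
have [_ _ g1] := Sg; have [_ _ h1] := Sh.
have ut1 : uniq [:: x; z; y] by rewrite /= !inE negb_or xy xz eq_sym yz.
have ut2 : uniq [:: y; z; x] by rewrite /= !inE negb_or yz ![_ == x]eq_sym xy xz.
have := (Xg _ _ _ mx my mz ut, Xg _ _ _ mx mz my ut1, Xg _ _ _ my mz mx ut2).
have := (Xh _ _ _ mx my mz ut, Xh _ _ _ mx mz my ut1, Xh _ _ _ my mz mx ut2).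
have := (g1 x y, g1 x z, g1 y z, (h1 x y, h1 x z, h1 y z)).
move=> [[[? ?] ?] [[? ?] ?]] [[? ?] ?] [[? ?] ?]; lia.
Qed.

(** In the application these count the link neighbours of [x] outside [A], outside [B] and outside
    [W]. The 6-set containing them has a point in [A] and another in [B], which leaves 5, 5 and
    4. *)
Definition outer_bounds g r c (sa sb : seq T) x :=
  [/\ \sum_(y <- sb) g x y + r x + c x <= 5,
      \sum_(y <- sa) g x y + r x + c x <= 5 & r x + c x <= 4].

(** The bounds when the 6-set has at least three points in [W]: 3 neighbours outside [W], plus one
    for each vertex of [W] taken into account. *)
Definition thin g r c (sa sb : seq T) x := {in sa & sb, forall y z,
  [/\ r x + c x <= 3, g x y + r x + c x <= 4, g x z + r x + c x <= 4
    & g x y + g x z + r x + c x <= 5]}.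

Definition link_profile g r c h s (sa sb : seq T) :=
  [/\ {in sa ++ sb, forall x, \sum_(y <- sa ++ sb) g x y + r x + c x <= 6},
      {in sa ++ sb, forall x, outer_bounds g r c sa sb x}
    & {in sa ++ sb, forall x, s x = 0} ->
     \sum_(x <- sa) \sum_(y <- sb) h x y <= 5 \/
     {in sa ++ sb, forall x, thin g r c sa sb x}].

Lemma in_seq6 (P : T -> Prop) a1 a2 a3 b1 b2 b3 :
  {in [:: a1; a2; a3; b1; b2; b3], forall x, P x} <->
  [/\ P a1, P a2, P a3 & [/\ P b1, P b2 & P b3]].
Proof.
split=> [H|[Pa1 Pa2 Pa3 [Pb1 Pb2 Pb3]] x].
  by do ![split]; apply: H; rewrite !inE eqxx ?orbT.
by rewrite !inE => /or4P[/eqP->|/eqP->|/eqP->|/or3P[] /eqP->].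
Qed.

(** Linear arithmetic over the 64 pairs of side shapes. The sum of the degree bounds counts an edge
    inside [W] twice and an outer edge once, while the total to be bounded counts both once. *)
Lemma weight_bound g h r s c a1 a2 a3 b1 b2 b3
    (sa := [:: a1; a2; a3]) (sb := [:: b1; b2; b3]) (W := sa ++ sb) :
    simple_adj g -> simple_adj h -> (forall x, c x <= 1) ->
    link_profile g r c h s sa sb -> link_profile h s c g r sa sb ->
    side_type g h r s a1 a2 a3 -> side_type g h r s b1 b2 b3 ->
  pair_sum g W + \sum_(x <- W) r x + (pair_sum h W + \sum_(x <- W) s x)
    + \sum_(x <- W) c x <= 36.
Proof.
move=> [gC g0 g1] [hC h0 h1] c1 [gD gO gT] [hD hO hT] sA sB.
have [? ? ? [? ? ?]] : [/\ c a1 <= 1, c a2 <= 1, c a3 <= 1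
    & [/\ c b1 <= 1, c b2 <= 1 & c b3 <= 1]] by [].
have gAB x : [/\ g x b1 <= 1, g x b2 <= 1 & g x b3 <= 1] by [].
have [[? ? ?] [? ? ?] [? ? ?]] := And3 (gAB a1) (gAB a2) (gAB a3).
have hAB x : [/\ h x b1 <= 1, h x b2 <= 1 & h x b3 <= 1] by [].
have [[? ? ?] [? ? ?] [? ? ?]] := And3 (hAB a1) (hAB a2) (hAB a3).
have {gD}/in_seq6 gD := gD; have {gO}/in_seq6 gO := gO.
have {hD}/in_seq6 hD := hD; have {hO}/in_seq6 hO := hO.
rewrite /outer_bounds !big_cons !big_nil !g0 ?(gC a2) ?(gC a3) ?(gC b1) ?(gC b2)
  ?(gC b3) in gD gO.
rewrite /outer_bounds !big_cons !big_nil !h0 ?(hC a2) ?(hC a3) ?(hC b1) ?(hC b2)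
  ?(hC b3) in hD hO.
rewrite /W /= !big_cons !big_nil.
case: gD hD => ? ? ? [? ? ?] [? ? ? [? ? ?]].
rewrite /side_type /lopsided /few /two_stars /near_star /one_edge /no_edge in sA sB.
(* [lia] does not look inside [and3] and [and4]: the outer bounds, needed for few
   pairs of types only, stay folded until the second round. *)
case: sA => [?|?|[?|[? ? ?]|?]|[?|[? ? ?]|?]];
  case: sB => [?|?|[?|[? ? ?]|?]|[?|[? ? ?]|?]]; try lia.
all: case: gO => [[? ? ?] [? ? ?] [? ? ?] [[? ? ?] [? ? ?] [? ? ?]]].
all: case: hO => [[? ? ?] [? ? ?] [? ? ?] [[? ? ?] [? ? ?] [? ? ?]]].
all: try lia.
(* Both sides are now one-edged or edgeless for the same link, which therefore has
   no edge leaving [W]. *)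
all: have a3A : a3 \in sa by rewrite !inE eqxx !orbT.
all: have b3B : b3 \in sb by rewrite !inE eqxx !orbT.
all: first
  [ have /gT[thinW|thinW] : {in W, forall x, s x = 0} by apply/in_seq6; do ![split]; lia
  | have /hT[thinW|thinW] : {in W, forall x, r x = 0} by apply/in_seq6; do ![split]; lia ].
all: try (rewrite !big_cons !big_nil in thinW; lia).
(* Thinness is needed only with respect to [a3] and [b3], the vertices where [one_edge] makes the
   outer degree of the other link vanish. *)
all: case/in_seq6: thinW
  => /(_ _ _ a3A b3B)[? ? ? ?] /(_ _ _ a3A b3B)[? ? ? ?] /(_ _ _ a3A b3B)[? ? ? ?].
all: case=> /(_ _ _ a3A b3B)[? ? ? ?] /(_ _ _ a3A b3B)[? ? ? ?] /(_ _ _ a3A b3B)[? ? ? ?].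
all: lia.
Qed.
End Weights.

(** * Vertex links in a 3-uniform family *)

Section Links.
Variables (T : finType) (F : {set {set T}}).
Hypothesis cardF : forall E, E \in F -> #|E| = 3.

Definition link (u x : T) : {set T} := [set y | [set u; x; y] \in F].

Definition star_off (u : T) (Z : {set T}) : {set {set T}} :=
  [set E in F | (u \in E) && [disjoint E & Z]].

Lemma link_uniq u x y : y \in link u x -> uniq [:: u; x; y].
Proof. by rewrite inE => /cardF/uniq_cards3. Qed.

Lemma link_sym u x y : (y \in link u x) = (x \in link u y).
Proof. by rewrite !inE setUAC. Qed.

Lemma link_rot u v x : (v \in link u x) = (u \in link v x).
Proof. by rewrite !inE setUC setUA setUAC (setUC [set v]). Qed.

Lemma link_irr u x : (x \in link u x) = false.
Proof. by apply/negP => /link_uniq /=; rewrite !inE eqxx !andbF. Qed.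

Lemma edge_third u x E : E \in F -> u \in E -> x \in E -> u != x ->
  exists2 y, E = [set u; x; y] & y \in link u x.
Proof.
move=> EF uE xE ux.
have EI : E :&: [set u; x] = [set u; x].
  by apply/setIidPr; rewrite subUset !sub1set uE.
have /cards1P[y Ey] : #|E :\: [set u; x]| == 1.
  by rewrite cardsD EI cards2 ux cardF.
have E_eq : E = [set u; x; y] by rewrite -Ey -{1}EI setID.
by exists y; rewrite // inE -E_eq.
Qed.

(** An edge at [u] off [Z] either contains [x], and is then determined by a link neighbour of [x]
    outside [Z], or survives when [x] joins [Z]. *)
Lemma star_off_step u x Z : u != x ->
  #|star_off u Z| <= #|link u x :\: Z| + #|star_off u (x |: Z)|.
Proof.
move=> ux; pose new := (fun y => [set u; x; y]) @: (link u x :\: Z).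
apply: (@leq_trans #|new :|: star_off u (x |: Z)|); last first.
  by rewrite (leq_trans (leq_card_setU _ _)) // leq_add2r leq_imset_card.
apply/subset_leq_card/subsetP => E; rewrite inE => /and3P[EF uE EZ].
rewrite inE; case: (boolP (x \in E)) => xE; apply/orP; [left|right].
  have [y Ey yl] := edge_third EF uE xE ux.
  apply/imsetP; exists y => //; rewrite inE yl andbT.
  by rewrite (disjointFr EZ) // Ey !inE eqxx orbT.
by rewrite inE EF uE disjoint_sym disjoint_setU1 xE disjoint_sym.
Qed.

Lemma cards_setD_seq (L Z : {set T}) (s : seq T) :
  uniq s -> [disjoint Z & [set:: s]] ->
  #|L :\: Z| = \sum_(y <- s) (y \in L) + #|L :\: (Z :|: [set:: s])|.
Proof.
elim: s Z => [|x s IH] Z /=; first by rewrite big_nil set_nil setU0.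
case/andP => xs us; rewrite set_cons disjoint_sym disjoint_setU1 => /andP[xZ dZ].
rewrite big_cons (cardsD1 x) !inE xZ /= -addnA; congr (_ + _).
rewrite setDDl [Z :|: [set x]]setUC setUCA setUA; apply: IH => //.
by rewrite disjoint_setU1 inE xs disjoint_sym.
Qed.

(** The vertices of [s] join [Z] one after another, so a link edge inside [s] is charged once, to
    its earlier end. *)
Lemma star_off_leq u (s : seq T) (Z : {set T}) : uniq s -> u \notin s ->
    [disjoint Z & [set:: s]] ->
  #|star_off u Z| <= pair_sum (fun x y => (y \in link u x) : nat) s
    + \sum_(x <- s) #|link u x :\: (Z :|: [set:: s])|
    + #|star_off u (Z :|: [set:: s])|.
Proof.
elim: s Z => [|x s IH] Z /=; first by rewrite big_nil set_nil setU0.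
case/andP => xs us; rewrite inE negb_or => /andP[ux us'].
rewrite set_cons disjoint_sym disjoint_setU1 => /andP[xZ dZ].
apply: (leq_trans (star_off_step Z ux)).
have d' : [disjoint x |: Z & [set:: s]] by rewrite disjoint_setU1 inE xs disjoint_sym.
have IHx := IH (x |: Z) us us' d'.
have -> : link u x :\: Z = link u x :\: (x |: Z).
  apply/setP => y; rewrite !(in_setD, in_setU1) negb_or.
  by case: eqVneq => //= ->; rewrite link_irr !andbF.
rewrite (cards_setD_seq _ us d') big_cons !(setUCA Z) !setUA.
by rewrite -!addnA leq_add2l [leqRHS]addnCA leq_add2l addnA.
Qed.
End Links.

(** * Families with no three disjoint edges and a disjoint pair off any two vertices *)

Section Configuration.
Variables (T : finType) (F : {set {set T}}).
Hypothesis cardF : forall E, E \in F -> #|E| = 3.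
Hypothesis meet_pair : forall C D E, C \in F -> D \in F -> E \in F ->
  [disjoint C & D] -> exists2 z, z \in E & z \in C :|: D.
Hypothesis pair_off : forall x y, exists C D,
  [/\ C \in F, D \in F, [disjoint C & D], x \notin C :|: D & y \notin C :|: D].

Local Notation link := (link F).

Definition adj u x y : nat := y \in link u x.
Definition rest v (W : {set T}) u x := #|link u x :\: (v |: W)|.

Lemma simple_adj_adj u : simple_adj (adj u).
Proof.
split=> [x y|x|x y]; rewrite /adj ?leq_b1 //; first by rewrite link_sym.
by rewrite (link_irr cardF).
Qed.

Lemma link_neq u x y : y \in link u x -> [/\ u != x, u != y & x != y].
Proof.
by move/(link_uniq cardF); rewrite /= !inE negb_or => /and3P[/andP[-> ->] ->].
Qed.

(* The last clause is about [S = C :|: D] where [v] lies on [C]: it names the other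
   two vertices of [C]. *)
Lemma cover u x : exists S : {set T}, [/\ #|S| = 6, u \notin S, link u x \subset S,
    forall E, E \in F -> exists2 z, z \in E & z \in S
  & forall v, v \in S -> exists f1 f2 D, [/\ D \in F, D \subset S,
      f2 \in link v f1, [set f1; f2] \subset S & [disjoint D & [set f1; f2]]]].
Proof.
have [C [D [CF DF CD uS xS]]] := pair_off u x; exists (C :|: D); split => //.
- by rewrite cardsU (disjoint_setI0 CD) cards0 !cardF.
- apply/subsetP => y; rewrite inE => yF; have [z] := meet_pair CF DF yF CD.
  rewrite (in_setU z [set _; _]) in_set2 in_set1 -orbA => /or3P[]/eqP-> // H.
    by rewrite H in uS.
  by rewrite H in xS.
- by move=> E EF; apply: meet_pair.
move=> v vS.
wlog vC : C D CF DF CD {uS xS vS} / v \in C => [hw|].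
  case/setUP: vS => [vC|vD]; first exact: hw vC.
  by rewrite setUC; apply: hw vD => //; rewrite disjoint_sym.
have [f1] : exists f1, f1 \in C :\ v.
  by apply/card_gt0P; have := cardsD1 v C; rewrite vC (cardF CF); lia.
rewrite in_setD1 eq_sym => /andP[vf1 f1C].
have [f2 Cf f2l] := edge_third cardF CF vC f1C vf1.
have fC : [set f1; f2] \subset C by rewrite Cf -setUA subsetUr.
exists f1, f2, D; split => //; first exact: subsetUr.
  exact: subset_trans fC (subsetUl _ _).
by rewrite disjoint_sym (disjointWl fC).
Qed.

(** * Degree bounds and edge count relative to a fixed disjoint pair *)

Section Pair.
Variables (u v : T) (A B : {set T}).
Hypotheses (AF : A \in F) (BF : B \in F) (AB : [disjoint A & B]).
Let W := A :|: B.
Hypotheses (uW : u \notin W) (vW : v \notin W).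
Variables (sa sb : seq T).
Hypotheses (sab : uniq (sa ++ sb)) (Asa : A = [set:: sa]) (Bsb : B = [set:: sb]).

Variable c : T -> nat.
Hypothesis cE : forall x, c x = adj u x v.

Lemma mem_W x : (x \in W) = (x \in sa ++ sb).
Proof. by rewrite /W Asa Bsb mem_cat !inE. Qed.

Lemma sum_adj (t : seq T) x : uniq t -> {subset t <= W} ->
  \sum_(y <- t) adj u x y + rest v W u x + c x = #|link u x :\: (W :\: [set:: t])|.
Proof.
move=> ut tW; have vt : v \notin t by apply: contra vW => /tW.
rewrite (@cards_setD_seq _ _ _ (v :: t)); last 2 first.
- by rewrite /= vt.
- rewrite set_cons disjoint_sym disjoint_setU1 in_setD (negPf vW) andbF /=.
  by rewrite disjoint_sym disjoint_subset; apply/subsetP => y; rewrite !inE => /andP[].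
rewrite big_cons addnC addnA; rewrite cE; congr (_ + _ + #|_ :\: _|).
apply/setP => y; rewrite set_cons !inE.
case: (y == v); rewrite ?orbT //=.
by case: (boolP (y \in t)) => [/tW|]; rewrite ?orbT ?orbF //= !inE.
Qed.

(** The neighbours counted lie in [S] and off [W :\: [set:: t]], so each point of [S] in that part
    lowers the bound 6 by one. *)
Lemma cover_bound (S : {set T}) (t : seq T) x : uniq t -> {subset t <= W} ->
    link u x \subset S -> #|S| = 6 ->
  \sum_(y <- t) adj u x y + rest v W u x + c x + #|S :&: (W :\: [set:: t])| <= 6.
Proof.
move=> ut tW lS S6; rewrite sum_adj // -[X in _ <= X]S6.
by rewrite -(cardsID (W :\: [set:: t]) S) addnC leq_add2l subset_leq_card // setSD.
Qed.

Lemma seq_W (t : seq T) : {subset t <= sa ++ sb} -> {subset t <= W}.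
Proof. by move=> tab x /tab; rewrite mem_W. Qed.

Lemma card_cover_part (S : {set T}) (t : seq T) :
  #|S :&: W| <= #|S :&: (W :\: [set:: t])| + size t.
Proof.
rewrite -(cardsID [set:: t] (S :&: W)) setIDA addnC leq_add2l.
apply: leq_trans (card_size t); apply: subset_leq_card.
by apply/subsetP => y; rewrite !inE => /andP[].
Qed.

Lemma cover_meets (S : {set T}) : (forall E, E \in F -> exists2 z, z \in E & z \in S) ->
  exists a b, [/\ a \in A, b \in B, a \in S, b \in S & a != b].
Proof.
move=> meetS; have [a aA aS] := meetS _ AF; have [b bB bS] := meetS _ BF.
exists a, b; split=> //; apply: contraTneq bB => <-.
by rewrite (disjointFr AB).
Qed.

Lemma adj_meets_W x y : v != x -> y \in link v x -> (x \in W) || (y \in W).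
Proof.
move=> vx; rewrite inE => /(meet_pair AF BF)/(_ AB) [z].
rewrite in_setU in_set2 in_set1 -orbA => /or3P[]/eqP-> zW.
- by rewrite (negPf vW) in zW.
- by rewrite /W zW.
- by rewrite /W zW orbT.
Qed.

(** A link edge of [v] has an end in [W], since it cannot form a third edge disjoint from [A] and
    [B]; the other end would be counted by [rest] if it were outside. *)
Lemma rest0_W x y : {in sa ++ sb, forall x, rest u W v x = 0} ->
  u != x -> u != y -> y \in link v x -> (x \in W) && (y \in W).
Proof.
move=> r0; wlog xW : x y / x \in W => [hw ux uy yx|ux uy yx].
  have [vx _ _] := link_neq yx.
  case/orP: (adj_meets_W vx yx) => [xW|yW]; first exact: hw.
  by rewrite andbC; apply: hw; rewrite // link_sym.
rewrite xW /=; have := r0 x; rewrite -mem_W => /(_ xW)/eqP; apply: contraTT => yW.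
rewrite cards_eq0; apply/set0Pn; exists y.
by rewrite in_setD yx andbT in_setU1 negb_or eq_sym uy.
Qed.

(** The support lies in one row and one column of a 3 by 3 array: 3 + 3 - 1 = 5. *)
Lemma sum_cross_leq5 (f : T -> T -> nat) a b : size sa = 3 -> size sb = 3 ->
    a \in sa -> b \in sb -> (forall x y, f x y <= 1) ->
    {in sa & sb, forall x y, x != a -> y != b -> f x y = 0} ->
  \sum_(x <- sa) \sum_(y <- sb) f x y <= 5.
Proof.
move=> sA sB aA bB f1 f0.
move: sab; rewrite cat_uniq => /and3P[usa _ usb].
have pa := perm_to_rem aA; have pb := perm_to_rem bB.
have := perm_size pa; have := perm_size pb; have := perm_uniq pa; have := perm_uniq pb.
have ma := perm_mem pa; have mb := perm_mem pb.
rewrite (perm_big _ pa) /=; under eq_bigr do rewrite (perm_big _ pb) /=.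
rewrite sA sB usa usb.
case: (rem a sa) ma => [|a1 [|a2 [|? ?]]] ma; rewrite ?andbF //.
case: (rem b sb) mb => [|b1 [|b2 [|? ?]]] mb; rewrite ?andbF //.
rewrite /= !inE !negb_or => /esym/and3P[/andP[bb1 bb2] _ _] /esym/and3P[/andP[aa1 aa2] _ _] _ _.
rewrite !big_cons !big_nil.
have f0' x y : x \in [:: a1; a2] -> y \in [:: b1; b2] -> f x y = 0.
  move=> xa yb; apply: f0.
  - by rewrite ma inE xa orbT.
  - by rewrite mb inE yb orbT.
  - by move: xa; rewrite !inE => /orP[]/eqP->; rewrite eq_sym.
  - by move: yb; rewrite !inE => /orP[]/eqP->; rewrite eq_sym.
rewrite (f0' a1 b1) ?(f0' a1 b2) ?(f0' a2 b1) ?(f0' a2 b2) ?inE ?eqxx ?orbT //.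
by move: (f1 a b) (f1 a b1) (f1 a b2) (f1 a1 b) (f1 a2 b); clear; lia.
Qed.

(* If the 6-set [S] covering [link u x] meets [W] in two points [a], [b] only, it does
   not contain [v], so every edge [{v, y, z}] with [y] in [A] and [z] in [B] has [y = a] or [z = b]. *)
Lemma sparse_or_thin x : {in sa ++ sb, forall x, rest u W v x = 0} ->
  \sum_(x <- sa) \sum_(y <- sb) adj v x y <= 5 \/ thin (adj u) (rest v W u) c sa sb x.
Proof.
move=> r0; have [S [S6 uS lS meetS vS]] := cover u x.
have [a [b [aA bB aS bS ab]]] := cover_meets meetS.
have [S3|S2] := leqP 3 #|S :&: W|; [right|left].
  (* At least [3 - size t] points of [S] lie in [W] off [t], so the bound 6 drops to
     [3 + size t]. *)
  have count (p k m l : nat) : p + k <= 6 -> m <= k + l -> 3 <= m -> p <= 3 + l.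
    by clear; lia.
  have bound t : uniq t -> {subset t <= W} ->
      \sum_(y <- t) adj u x y + rest v W u x + c x <= 3 + size t.
    by move=> ut tW; apply: count (cover_bound ut tW lS S6) (card_cover_part S t) S3.
  move=> y z yA zB; have [yW zW] : y \in W /\ z \in W.
    by rewrite !mem_W !mem_cat yA zB orbT.
  have yz : y != z.
    move: sab; rewrite cat_uniq => /and3P[_ /hasPn/(_ _ zB) zA _].
    by apply: contraNneq zA => <-.
  have := bound [:: y; z]; rewrite /= !inE yz !big_cons !big_nil => /(_ isT) b3.
  have := bound [:: y]; rewrite !big_cons !big_nil => /(_ isT) b1.
  have := bound [:: z]; rewrite !big_cons !big_nil => /(_ isT) b2.
  have := bound [::]; rewrite !big_nil => /(_ isT) b0.
  split.
  - by apply: leq_trans (b0 _).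
  - by have := b1 _; rewrite addn0; apply=> ?; rewrite inE => /eqP->.
  - by have := b2 _; rewrite addn0; apply=> ?; rewrite inE => /eqP->.
  - by have := b3 _; rewrite addn0; apply=> ?; rewrite in_cons mem_seq1 => /orP[]/eqP->.
have Wab (t1 t2 t3 : T) : uniq [:: t1; t2; t3] -> t1 \in S :&: W -> t2 \in S :&: W ->
    t3 \in S :&: W -> False.
  move=> ut m1 m2 m3; have := S2; rewrite ltnNge => /negP; apply.
  rewrite -[3]/(size [:: t1; t2; t3]) -(card_uniqP ut) subset_leq_card //.
  by apply/subsetP => t; rewrite 2!in_cons mem_seq1 => /or3P[]/eqP->.
have aSW : a \in S :&: W by rewrite inE aS /W inE aA.
have bSW : b \in S :&: W by rewrite inE bS /W inE bB orbT.
have SWab z : z \in S -> z \in W -> (z == a) || (z == b).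
  move=> zS zW; apply/negPn; rewrite negb_or; apply/negP => /andP[za zb].
  have zSW : z \in S :&: W by rewrite in_setI zS zW.
  by apply: (Wab a b z _ aSW bSW zSW); rewrite /= !inE negb_or ab ![_ == z]eq_sym za zb.
(* Otherwise [S] consists of an edge [[set v; f1; f2]] and an edge [D] disjoint from it. Both [f1]
   and [f2] lie in [W] because no link edge of [v] leaves [W], and [D] meets [W] in a third point of
   [S]. *)
have vnS : v \notin S.
  apply/negP => /vS[f1 [f2 [D [DF DS f2l fS fD]]]].
  have f1S : f1 \in S by apply: (subsetP fS); rewrite set21.
  have f2S : f2 \in S by apply: (subsetP fS); rewrite set22.
  have uf1 : u != f1 by apply: contraNneq uS => ->.
  have uf2 : u != f2 by apply: contraNneq uS => ->.
  have [_ _ f12] := link_neq f2l.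
  have /andP[f1W f2W] := rest0_W r0 uf1 uf2 f2l.
  have [d dD dW] := meet_pair AF BF DF AB.
  have := disjointFr fD dD; rewrite in_set2 => /negbT; rewrite negb_or => /andP[df1 df2].
  apply: (Wab f1 f2 d); rewrite ?in_setI ?f1S ?f2S ?f1W ?f2W ?(subsetP DS) //.
  by rewrite /= !inE negb_or f12 ![_ == d]eq_sym df1 df2.
have [A3 B3] := (cardF AF, cardF BF).
move: sab; rewrite cat_uniq => /and3P[usa _ usb].
apply: (@sum_cross_leq5 _ a b).
- by rewrite -A3 Asa cardsE (card_uniqP usa).
- by rewrite -B3 Bsb cardsE (card_uniqP usb).
- by rewrite Asa inE in aA.
- by rewrite Bsb inE in bB.
- by move=> y z; apply: leq_b1.
move=> y z ya zb yna znb; apply/eqP; rewrite eqb0; apply/negP => zl.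
have [t] : exists2 t, t \in [set v; y; z] & t \in S by apply: meetS; rewrite inE in zl.
have yA : y \in A by rewrite Asa inE.
have zB : z \in B by rewrite Bsb inE.
rewrite !inE -orbA => /or3P[]/eqP-> tS; first by rewrite tS in vnS.
  have := SWab _ tS; rewrite inE yA (negPf yna) => /(_ isT)/eqP yb.
  by rewrite -yb (disjointFr AB yA) in bB.
have := SWab _ tS; rewrite inE zB orbT (negPf znb) orbF => /(_ isT)/eqP za.
by rewrite -za (disjointFl AB zB) in aA.
Qed.

Lemma link_profile_adj :
  link_profile (adj u) (rest v W u) c (adj v) (rest u W v) sa sb.
Proof.
move: (sab); rewrite cat_uniq => /and3P[usa _ usb].
split=> [x _|x _|r0].
- have [S [S6 _ lS _ _]] := cover u x.
  apply: leq_trans (cover_bound sab _ lS S6); first exact: leq_addr.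
  by move=> y; rewrite mem_W.
- have [S [S6 _ lS meetS _]] := cover u x.
  have [a [b [aA bB aS bS ab]]] := cover_meets meetS.
  have bound t : uniq t -> {subset t <= sa ++ sb} ->
      \sum_(y <- t) adj u x y + rest v W u x + c x + #|S :&: (W :\: [set:: t])| <= 6.
    by move=> ut tab; apply: cover_bound => //; apply: seq_W.
  split.
  + have sub : {subset sb <= sa ++ sb} by move=> y yb; rewrite mem_cat yb orbT.
    have aS' : a \in S :&: (W :\: [set:: sb]) by rewrite -Bsb !inE aS aA (disjointFr AB aA).
    by move: (bound sb usb sub); rewrite (cardsD1 a) aS'; clear; lia.
  + have sub : {subset sa <= sa ++ sb} by move=> y yb; rewrite mem_cat yb.
    have bS' : b \in S :&: (W :\: [set:: sa]) by rewrite -Asa !inE bS bB (disjointFl AB bB) orbT.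
    by move: (bound sa usa sub); rewrite (cardsD1 b) bS'; clear; lia.
  + have ab2 : 2 <= #|S :&: W|.
      rewrite -[2]/(true.+1) -ab -cards2 subset_leq_card // subUset !sub1set.
      by rewrite !inE aS bS aA bB orbT.
    have sub : {subset [::] <= sa ++ sb} by [].
    move: (bound [::] isT sub) (card_cover_part S [::]) ab2; rewrite big_nil /=.
    by clear; lia.
(* The first alternative does not depend on [x], so its failure gives thinness at every vertex. *)
have [sp|sp] := leqP (\sum_(x <- sa) \sum_(y <- sb) adj v x y) 5; [by left|right].
by move=> x _; case: (sparse_or_thin x r0) => //; rewrite leqNgt sp.
Qed.

Lemma set_seq_W : [set:: sa ++ sb] = W.
Proof. by apply/setP => x; rewrite mem_W inE. Qed.

Lemma star_off_W w (Z : {set T}) : star_off F w (Z :|: W) = set0.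
Proof.
apply/setP => E; rewrite !inE; apply/negP => /and3P[EF _ EZ].
have [z zE zW] := meet_pair AF BF EF AB.
by have := disjointFr EZ zE; rewrite in_setU zW orbT.
Qed.

Lemma card_meeting_leq :
  #|[set E in F | E :&: [set u; v] != set0]| <=
    pair_sum (adj u) (sa ++ sb) + \sum_(x <- sa ++ sb) rest v W u x
    + (pair_sum (adj v) (sa ++ sb) + \sum_(x <- sa ++ sb) rest u W v x)
    + \sum_(x <- sa ++ sb) c x.
Proof.
have us : u \notin sa ++ sb by rewrite -mem_W.
have vs : v \notin sa ++ sb by rewrite -mem_W.
(* Edges containing both [u] and [v] are counted at [v] only. *)
apply: (@leq_trans (#|star_off F u [set v]| + #|star_off F v set0|)).
  apply: leq_trans (leq_card_setU _ _); apply/subset_leq_card/subsetP => E.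
  rewrite !inE => /andP[EF /set0Pn[z]]; rewrite !inE => /andP[zE zuv].
  have -> : [disjoint E & set0] by rewrite -setI_eq0 setI0.
  have -> : [disjoint E & [set v]] = (v \notin E) by rewrite disjoint_sym disjoints1.
  by rewrite EF; case/orP: zuv zE => /eqP-> ->; rewrite ?orbT //; case: (v \in E).
have Hu := @star_off_leq _ _ cardF u (sa ++ sb) [set v] sab us.
have Hv := @star_off_leq _ _ cardF v (sa ++ sb) set0 sab vs.
rewrite set_seq_W star_off_W cards0 addn0 disjoints1 in Hu.
rewrite set_seq_W star_off_W cards0 addn0 set0U in Hv.
rewrite -addnA; apply: leq_add; first exact: Hu.
apply: leq_trans (Hv _) _; first by rewrite -setI_eq0 set0I.
rewrite -addnA leq_add2l -big_split /=; apply: leq_sum => x _.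
(* Separating [u] from the link neighbours of [x] at [v] produces the term [c x]. *)
rewrite (@cards_setD_seq _ _ W [:: u]) //; last first.
  by rewrite set_cons set_nil setU0 disjoint_sym disjoints1.
by rewrite big_seq1 cE /adj link_rot addnC setUC set_cons set_nil setU0.
Qed.

End Pair.

(** * Cross-intersection of the two links outside an edge *)

Lemma cross_edges u v E x y z w : E \in F -> y \in link u x -> w \in link v z ->
    [disjoint [:: u; x; y] & [:: v; z; w]] ->
  ~~ [disjoint E & [:: u; x; y; v; z; w]].
Proof.
rewrite !inE => EF yF wF dis.
have [t tE] : exists2 t, t \in E & t \in [set u; x; y] :|: [set v; z; w].
  apply: meet_pair => //; move: dis; apply: etrans.
  by apply: etrans (eq_disjoint _ _) (eq_disjoint_r _ _) => ?; rewrite !inE -orbA.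
rewrite !inE -!orbA => tS; apply/negP => /disjointFr/(_ tE).
by rewrite !inE tS.
Qed.

Lemma restP v W u x : 0 < rest v W u x -> exists2 y, y \in link u x & y \notin v |: W.
Proof. by case/card_gt0P => y; rewrite inE => /andP[]; exists y. Qed.

Section Side.
Variables (u v : T) (E W : {set T}) (t : seq T).
Hypotheses (uv : u != v) (EF : E \in F) (EW : E \subset W).
Hypotheses (uW : u \notin W) (vW : v \notin W).
Hypotheses (tW : {subset t <= W}) (tE : {in t, forall x, x \notin E}).

(** If [w] is an outer neighbour of [z] in the link of [v], then [[set u; x; y]], [[set v; z; w]]
    and [E] would be three disjoint edges. *)
Lemma exclusive_adj : exclusive (adj u) (rest u W v) t.
Proof.
move=> x y z xt yt zt; rewrite /= !inE negb_or => /and3P[/andP[xy xz] yz _].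
rewrite lt0b => yl; apply/eqP; rewrite eqn0Ngt; apply/negP => /restP[w wl].
rewrite in_setU1 negb_or => /andP[wu wW].
have neqW (a b : T) : a \in t -> b \notin W -> a != b.
  by move=> /tW aW; apply: contraNneq => <-.
have notE (a : T) : a \notin W -> a \notin E by apply: contra => /(subsetP EW).
have dis : [disjoint [:: u; x; y] & [:: v; z; w]].
  rewrite disjoint_has /= orbF !inE !negb_or uv xz yz !(eq_sym u) wu.
  by rewrite !neqW.
apply: (negP (cross_edges EF yl wl dis)).
rewrite disjoint_sym disjoint_has /= orbF !negb_or.
by rewrite (notE u) // (notE v) // (notE w) // !tE.
Qed.

(** Of two outer neighbours of [x], one differs from the given outer neighbour of the other vertex,
    and three disjoint edges appear again. *)
Lemma balanced_adj : balanced (rest v W u) (rest u W v) t.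
Proof.
move=> x z xt zt xz /restP[w wl]; rewrite in_setU1 negb_or => /andP[wu wW].
rewrite leqNgt /rest (cardsD1 w); apply/negP => r2.
have [y] : exists y, y \in (link u x :\: (v |: W)) :\ w.
  by apply/card_gt0P; move: r2; case: (w \in _) => // /ltnW.
rewrite !inE !negb_or => /and3P[yw /andP[yv yW] yl].
have neqW (a b : T) : a \in t -> b \notin W -> a != b.
  by move=> /tW aW; apply: contraNneq => <-.
have notE (a : T) : a \notin W -> a \notin E by apply: contra => /(subsetP EW).
have yl' : y \in link u x by rewrite inE.
have dis : [disjoint [:: u; x; y] & [:: v; z; w]].
  rewrite disjoint_has /= orbF !inE !negb_or uv xz yw yv !(eq_sym u) wu !(eq_sym y).
  by rewrite !neqW.
apply: (negP (cross_edges EF yl' wl dis)).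
rewrite disjoint_sym disjoint_has /= orbF !negb_or.
by rewrite (notE u) // (notE v) // (notE w) // (notE y) // !tE.
Qed.
End Side.

Lemma card_meeting_leq36 u v : u != v ->
  #|[set E in F | E :&: [set u; v] != set0]| <= 36.
Proof.
move=> uv; have [A [B [AF BF AB uW vW]]] := pair_off u v.
pose W := A :|: B; pose r := rest v W u; pose s := rest u W v.
have side E E' : E \in F -> E' \in F -> [disjoint E & E'] -> E :|: E' = W -> exists x y z,
    [/\ E' = [set:: [:: x; y; z]], uniq [:: x; y; z] & side_type (adj u) (adj v) r s x y z].
  move=> EF E'F EE' EW.
  have size_E' : size (enum E') = 3 by rewrite -cardE cardF.
  have tE x : x \in enum E' -> x \notin E by rewrite mem_enum => xE'; rewrite (disjointFl EE' xE').
  have tW : {subset enum E' <= W} by move=> x; rewrite mem_enum -EW inE => ->; rewrite orbT.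
  have EsW : E \subset W by rewrite -EW subsetUl.
  have vu : v != u by rewrite eq_sym.
  have [x [y [z [p st]]]] := side_typeP size_E' (simple_adj_adj u) (simple_adj_adj v) (enum_uniq E')
    (exclusive_adj uv EF EsW uW vW tW tE) (exclusive_adj vu EF EsW vW uW tW tE)
    (balanced_adj uv EF EsW uW vW tW tE) (balanced_adj vu EF EsW vW uW tW tE).
  exists x, y, z; split => //; last by rewrite (perm_uniq p) enum_uniq.
  by apply/setP => a; rewrite inE (perm_mem p) mem_enum.
have BA : [disjoint B & A] by rewrite disjoint_sym.
(* The shape of a side dictates the order of its vertices, so [A] and [B] are enumerated only
   here. *)
have [b1 [b2 [b3 [Bb ub sB]]]] := side A B AF BF AB erefl.
have [a1 [a2 [a3 [Aa ua sA]]]] := side B A BF AF BA (setUC _ _).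
have sab : uniq ([:: a1; a2; a3] ++ [:: b1; b2; b3]).
  rewrite cat_uniq ua ub andbT -(disjoint_has [:: b1; b2; b3]); move: BA; apply: etrans.
  by apply: etrans (eq_disjoint _ _) (eq_disjoint_r _ _) => x; rewrite ?Aa ?Bb inE.
apply: leq_trans (card_meeting_leq AF BF AB uW vW sab Aa Bb (c := (adj u)^~ v) _) _ => //.
apply: (weight_bound (c := (adj u)^~ v) (simple_adj_adj u) (simple_adj_adj v) _ _ _ sA sB).
- by move=> x; apply: leq_b1.
- exact: link_profile_adj.
- by apply: link_profile_adj => // x; rewrite /adj link_rot.
Qed.
End Configuration.

(** * From matching number and resilience to the local hypotheses *)

Lemma matching2_meet n (F : {set {set 'I_n}}) (C D E : {set 'I_n}) :
    F \subset ksubsets n 3 -> matching_number F = 2 ->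
    C \in F -> D \in F -> E \in F -> [disjoint C & D] ->
  exists2 z, z \in E & z \in C :|: D.
Proof.
move=> F3 nu CF DF EF CD; apply/exists_inP; apply: contraT; rewrite negb_exists_in.
move=> /forall_inP noz.
have card3 X : X \in F -> #|X| = 3 by move/(subsetP F3); rewrite inE => /eqP.
have disE (X : {set 'I_n}) : X \subset C :|: D -> [disjoint X & E].
  move=> XCD; rewrite disjoint_sym disjoint_subset; apply/subsetP => z zE.
  by apply: contra (noz z zE); apply: (subsetP XCD).
have CE := disE C (subsetUl _ _); have DE := disE D (subsetUr _ _).
have neq (X Y : {set 'I_n}) : X \in F -> [disjoint X & Y] -> X != Y.
  move=> XF; apply: contraTneq => <-; rewrite -setI_eq0 setIid -cards_eq0.
  by rewrite (card3 _ XF).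
suff : 3 <= matching_number F by rewrite nu.
have <- : #|[set C; D; E]| = 3.
  by rewrite setUC cardsU1 cards2 !inE negb_or ![E == _]eq_sym !neq.
apply: (@leq_bigmax_cond _ _ (fun M : {set {set 'I_n}} => #|M|)); apply/andP; split.
  by apply/subsetP => X; rewrite !inE -orbA => /or3P[]/eqP->.
apply/trivIsetP => X Y; rewrite !inE -!orbA.
by case/or3P=> /eqP-> /or3P[]/eqP-> //; rewrite ?eqxx // disjoint_sym.
Qed.

Lemma matching2_pair n (F : {set {set 'I_n}}) : matching_number F = 2 ->
  exists C D, [/\ C \in F, D \in F & [disjoint C & D]].
Proof.
rewrite /matching_number => nu.
have [|M /andP[MF Mtriv] MM] := @eq_bigmax_cond _
  (fun M : {set {set 'I_n}} => (M \subset F) && trivIset M) (fun M => #|M|).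
  (* The empty matching makes the index set nonempty, so the maximum is attained. *)
  by apply/card_gt0P; exists set0; rewrite unfold_in sub0set; apply/trivIsetP => ?; rewrite inE.
have /cards2P[C [D [CD ME]]] : #|M| == 2 by rewrite -MM nu.
exists C, D; split; [apply: (subsetP MF)|apply: (subsetP MF)|];
  rewrite ?ME ?set21 ?set22 //.
by apply: (trivIsetP Mtriv); rewrite // ME ?set21 ?set22.
Qed.

Theorem lemma1p7 (n : nat) (F : {set {set 'I_n}})
    (hF3 : F \subset ksubsets n 3)
    (hres : resilient 2 F)
    (hnu : matching_number F = 2)
    (u v : 'I_n) :
  #|meeting F [set u; v]| <= 36.
Proof.
have cardF E : E \in F -> #|E| = 3 by move/(subsetP hF3); rewrite inE => /eqP.
have meet_pair C D E := @matching2_meet n F C D E hF3 hnu.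
have pair_off x y : exists C D,
    [/\ C \in F, D \in F, [disjoint C & D], x \notin C :|: D & y \notin C :|: D].
  have xy2 : #|[set x; y]| <= 2 by rewrite cards2; case: (x != y).
  have [C [D []]] := matching2_pair (etrans (hres _ xy2) hnu).
  rewrite !inE !setI_eq0 => /andP[CF Cxy] /andP[DF Dxy] CD; exists C, D; split => //.
    by rewrite !inE (disjointFl Cxy) ?(disjointFl Dxy) ?set21.
  by rewrite !inE (disjointFl Cxy) ?(disjointFl Dxy) ?set22.
have [uv|] := eqVneq u v; last exact: card_meeting_leq36.
(* For [u = v] any [w] other than [u] will do, since enlarging [[set u]] to [[set u; w]] loses no
   edge; an edge avoiding [u] supplies such a [w]. *)
have [A [B [AF _ _ uA _]]] := pair_off u u.
have [w wA] : exists w, w \in A by apply/card_gt0P; rewrite cardF.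
have uw : u != w by apply: contraNneq uA => ->; rewrite inE wA.
apply: leq_trans (card_meeting_leq36 cardF meet_pair pair_off uw).
apply/subset_leq_card/subsetP => E; rewrite !inE -uv setUid => /andP[-> /set0Pn[z]].
by rewrite inE => /andP[zE zu]; apply/set0Pn; exists z; rewrite !inE zE -in_set1 zu.
Qed.
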